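(* Consider the lost-sales inventory model with caps $\lambda_t\in[0,\bar D]$, carry-safe caps $a_t=\min_{s=t,\ldots,T}\lambda_s$ and critical ratios $q_t=p_t/(h_t+p_t)$. Suppose the conditional noninformative-censoring assumption (see context) holds, $x_1\in[0,a_1]$, and $$F_t^-(a_t)>q_t,\qquad t\in[T].$$ Let $X_t^*$ and $Y_t^*$ denote the inventory before and after ordering in period $t$ under the base-stock policy $\pi^{S^*}$ started at $X_1^*=x_1$. Then $S_t^*<a_t$ for every $t\in[T]$, and this optimal lost-sales trajectory satisfies $X_t^*\le a_t$ and $Y_t^*\le a_t$ in every period. Moreover, restricting each Bellman minimization to $x\le y\le a_t$ preserves the full-information optimal value for every $t\in[T]$ and $x\in[0,a_t]$: that is, the recursion $\tilde V_{T+1}=0$, $\tilde V_t(x)=\min_{x\le y\le a_t}\{C_t(y)+\mathbb E[\tilde V_{t+1}((y-D_t)^+)]\}$ satisfies $\tilde V_t(x)=V_t^*(x)$ for every $t\in[T]$ and $x\in[0,a_t]$.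
   Context: Lost-sales inventory model. Horizon $T$; $[n]=\{1,\ldots,n\}$, $u^+=\max\{u,0\}$. Demands $D_1,\ldots,D_T$ are independent with laws $P_t$ supported on $[0,\bar D]$, $\bar D>0$; $F_t^-(u)=\mathbb P(D_t<u)$. Holding and shortage coefficients $h_t,p_t>0$ are known; fixed and per-unit ordering costs, lead time, and terminal salvage value are zero. Starting period $t$ with inventory $x_t\ge0$, the retailer chooses a post-order level $y_t\ge x_t$ before demand and incurs $c_t(y_t,D_t)$ with $c_t(y,d)=h_t(y-d)^++p_t(d-y)^+$; $C_t(y)=\mathbb E[c_t(y,D_t)]$. The next state is $(y_t-D_t)^+$. Feasible policies use the information then available and may randomize; $V_t^\pi(x)$ is the expected total cost from period $t$ and state $x$, $V_t^*(x)=\inf_\pi V_t^\pi(x)$, and $$V_{T+1}^*=0,\quad U_t(y)=C_t(y)+\mathbb E[V_{t+1}^*((y-D_t)^+)],\quad V_t^*(x)=\min_{y\ge \max\{x,0\}}U_t(y).$$ $S_t^*=\min\arg\min_{y\ge0}U_t(y)$ is the smallest optimal base-stock level, $S^*=(S_1^*,\ldots,S_T^* )$, and $\pi^{S^*}$ is the policy $\pi_t^{S^*}(x)=\max\{x,S_t^*\}$. Sales logs and caps. Offline data are logs $((Z_t^j,b_t^j):t\in[T],j\in[N_t])$ with known boundary $b_t^j\ge0$ and $Z_t^j=\min\{D_t^j,b_t^j\}$, where $D_t^j$ is a latent fitting demand. Conditional noninformative censoring: conditional on the complete boundary array $\mathcal B=(b_t^j)$, all latent $D_t^j$ are mutually independent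 and $D_t^j$ has law $P_t$; each boundary is fixed or determined before its own demand. The numbers $\lambda_t$ are chosen before observing fitting demands, or using only $\mathcal B$; an independent pilot is also allowed if, conditional on the pilot, design information, and complete boundaries, fitting demands remain independent with laws $P_t$. *)

(* Defs.v *)
From mathcomp Require Export all_boot all_order all_algebra.
From mathcomp Require Export all_classical all_reals all_analysis.

Set Implicit Arguments.
Unset Strict Implicit.
Unset Printing Implicit Defensive.

Import Order.TTheory GRing.Theory Num.Theory.
Import numFieldNormedType.Exports.

Local Open Scope classical_set_scope.
Local Open Scope ring_scope.

(* Periods are natural numbers 1, ..., T; time-indexed data are sequences on
   nat whose values outside the horizon are never used. *)
Definition period (T t : nat) : bool := (1 <= t <= T)%N.

Definition pospart (R : realType) (u : R) : R := Num.max u 0.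

(** * Independence *)

Section independence.
Context (R : realType) (d : measure_display) (Omega : measurableType d).
Variable P : probability Omega R.

Definition mutually_independent (I : choiceType) (J : pred I)
    (X : I -> Omega -> R) : Prop :=
  forall (s : seq I) (A : I -> set R), uniq s -> all J s ->
    (forall i, measurable (A i)) ->
    P (\bigcap_(i in [set` s]) X i @^-1` A i) =
    \big[*%E/1%E]_(i <- s) P (X i @^-1` A i).

Definition has_law (X : Omega -> R) (mu : probability R R) : Prop :=
  forall A : set R, measurable A -> P (X @^-1` A) = mu A.

Definition sub_sigma_algebra (G : set (set Omega)) : Prop :=
  sigma_algebra [set: Omega] G /\ G `<=` measurable.

Definition measurable_wrt (G : set (set Omega)) (X : Omega -> R) : Prop :=
  forall A : set R, measurable A -> G (X @^-1` A).

(* g is a version of the conditional probability of E given G. *)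
Definition cond_prob_version (G : set (set Omega)) (E : set Omega)
    (g : Omega -> R) : Prop :=
  [/\ measurable_wrt G g, forall w, 0 <= g w &
      forall F, G F -> (\int[P]_(w in F) (g w)%:E)%E = P (E `&` F)].

(* Conditionally on G, the X_i (i in J) are mutually independent and X_i has
   the nonrandom law mu_i. *)
Definition cond_independent_with_laws (G : set (set Omega)) (I : choiceType)
    (J : pred I) (X : I -> Omega -> R) (mu : I -> probability R R) : Prop :=
  forall (s : seq I) (A : I -> set R), uniq s -> all J s ->
    (forall i, measurable (A i)) ->
    cond_prob_version G (\bigcap_(i in [set` s]) X i @^-1` A i)
      (cst (\prod_(i <- s) fine (mu i (A i)))).

Definition independent_of_sigma (G : set (set Omega)) (X : Omega -> R) : Prop :=
  forall (F : set Omega) (A : set R), G F -> measurable A ->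
    P (F `&` X @^-1` A) = (P F * P (X @^-1` A))%E.

End independence.

(** * The lost-sales model *)

Record model (R : realType) := Model {
  horizon : nat;
  law : nat -> probability R R;
  holding : nat -> R;
  shortage : nat -> R }.

Section lost_sales.
Context (R : realType) (M : model R).
Local Notation T := (horizon M).

Definition cost (t : nat) (y d : R) : R :=
  holding M t * pospart (y - d) + shortage M t * pospart (d - y).

Definition mean_cost (t : nat) (y : R) : \bar R :=
  (\int[law M t]_d (cost t y d)%:E)%E.

Definition critical_ratio (t : nat) : R :=
  shortage M t / (holding M t + shortage M t).

Definition Fminus (t : nat) (u : R) : \bar R := law M t [set v | v < u].

(* What has been observed after k completed periods, most recent first:
   x_k, y_{k-1}, x_{k-1}, ..., y_0, x_0.  The (censored) sales are
   y_i - x_{i+1}, so they carry no further information. *)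
Definition history (k : nat) := (k.*2.+1).-tuple R.

Definition extend_history (k : nat) (h : history k) (y x : R) : history k.+1 :=
  [tuple of x :: y :: h].

(* [pi s k] draws the post-order level in period s when k periods have already
   been run, so that a single policy can be started in any period. *)
Definition policy := forall s k : nat, R.-pker history k ~> R.

Definition feasible (pi : policy) : Prop :=
  forall s k (h : history k),
    pi s k h [set y | Num.max (thead h) 0 <= y] = 1%E.

(* Expectation of acc plus the costs of the n periods s, ..., s+n-1: the
   iterated integral of the accumulated cost against the trajectory law. *)
Fixpoint expected_cost (pi : policy) (n s k : nat) (h : history k) (acc : R)
    : \bar R :=
  match n with
  | 0 => acc%:E
  | n'.+1 =>
      (\int[pi s k h]_y \int[law M s]_d
         expected_cost pi n' s.+1 (extend_history h y (pospart (y - d)))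
           (acc + cost s y d))%E
  end.

Definition policy_value (pi : policy) (t : nat) (x : R) : \bar R :=
  expected_cost pi (T.+1 - t) t ([tuple x] : history 0) 0.

Definition optimal_value (t : nat) (x : R) : \bar R :=
  ereal_inf [set policy_value pi t x | pi in [set pi | feasible pi]].

Definition post_order_value (t : nat) (y : R) : \bar R :=
  (mean_cost t y + \int[law M t]_d optimal_value t.+1 (pospart (y - d)))%E.

Definition minimizers (t : nat) : set R :=
  [set y | 0 <= y /\
     forall z, 0 <= z -> (post_order_value t y <= post_order_value t z)%E].

Definition Sstar (t : nat) : R := inf (minimizers t).

Definition base_stock (S : nat -> R) (t : nat) (x : R) : R := Num.max x (S t).

(* Pre-order inventory under the base-stock policy; period 1 starts at x1 and
   index 0 is not a period. *)
Fixpoint pre_order (S : nat -> R) (x1 : R) (dem : nat -> R) (t : nat) : R :=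
  match t with
  | 0 => x1
  | s.+1 => if s is 0 then x1
            else pospart (base_stock S s (pre_order S x1 dem s) - dem s)
  end.

Definition post_order (S : nat -> R) (x1 : R) (dem : nat -> R) (t : nat) : R :=
  base_stock S t (pre_order S x1 dem t).

Definition carry_cap (lam : nat -> R) (t : nat) : R :=
  \big[Num.min/lam T]_(t <= s < T.+1) lam s.

Fixpoint capped_rec (a : nat -> R) (n t : nat) (x : R) : \bar R :=
  match n with
  | 0 => 0%E
  | n'.+1 =>
      ereal_inf [set (mean_cost t y +
          \int[law M t]_d capped_rec a n' t.+1 (pospart (y - d)))%E
        | y in [set y | x <= y <= a t]]
  end.

Definition capped_value (a : nat -> R) (t : nat) : R -> \bar R :=
  capped_rec a (T.+1 - t) t.

Definition capped_post_order_value (a : nat -> R) (t : nat) (y : R) : \bar R :=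
  (mean_cost t y + \int[law M t]_d capped_value a t.+1 (pospart (y - d)))%E.

End lost_sales.

(** * Censored sales logs *)

(* The records of period t are numbered 1, ..., log_size t. *)
Record sales_log (R : realType) (d : measure_display)
    (Omega : measurableType d) (Q : probability Omega R) := SalesLog {
  log_size : nat -> nat;
  boundary : nat -> nat -> {RV Q >-> R};
  latent : nat -> nat -> {RV Q >-> R};
  sale : nat -> nat -> {RV Q >-> R};
  saleE : forall t j w, sale t j w = Num.min (latent t j w) (boundary t j w) }.

Section logs.
Context (R : realType) (d : measure_display) (Omega : measurableType d).
Context (Q : probability Omega R) (M : model R) (L : sales_log Q).

Definition log_index : pred (nat * nat) :=
  [pred tj | period (horizon M) tj.1 && (1 <= tj.2 <= log_size L tj.1)%N].

Definition boundary_sigma : set (set Omega) :=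
  <<s [set E | exists tj (A : set R),
         [/\ log_index tj, measurable A & E = boundary L tj.1 tj.2 @^-1` A]] >>.

Definition fitting_demands_given (G : set (set Omega)) : Prop :=
  cond_independent_with_laws Q G log_index
    (fun tj => latent L tj.1 tj.2) (fun tj => law M tj.1).

(* The third clause says that each boundary is known from information that is
   independent of (i.e. predates) the demand it censors; a fixed boundary is
   the case of the trivial sigma-algebra. *)
Definition noninformative_censoring : Prop :=
  [/\ forall tj w, log_index tj -> 0 <= boundary L tj.1 tj.2 w,
      fitting_demands_given boundary_sigma &
      forall tj, log_index tj -> exists G : set (set Omega),
        [/\ sub_sigma_algebra G, measurable_wrt G (boundary L tj.1 tj.2) &
            independent_of_sigma Q G (latent L tj.1 tj.2)]].

(* The caps depend only on design information G, which contains the complete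
   boundary array and possibly an independent pilot, and given which the
   fitting demands are still independent with the laws of the model. *)
Definition admissible_caps (lam : nat -> Omega -> R) : Prop :=
  exists G : set (set Omega),
    [/\ sub_sigma_algebra G, boundary_sigma `<=` G, fitting_demands_given G &
        forall t, period (horizon M) t -> measurable_wrt G (lam t)].

End logs.

(* Main.v *)
(**
Backward induction shows that the optimal value V_t over all randomized
history-dependent policies is nonnegative, nondecreasing, convex and Lipschitz
on the whole line, and that V_t(x) = U_t(max x S_t).  Indeed U_t(y) is the
expectation of a convex Lipschitz function of y - D_t which grows at least like
h_t y, so it has a least nonnegative minimizer S_t and is nondecreasing above
it.  No policy can beat this value, by integrating the induction hypothesis
along the trajectory, and the base-stock policy attains it.

Since V_{t+1} is nondecreasing, a level u < a_t with P(D_t < u) > q_t satisfies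
U_t(u) < U_t(a_t), and convexity forces S_t < a_t.  The caps a_t are
nondecreasing in t and demands are almost surely nonnegative, so a level below
a_t is carried over to an inventory below a_{t+1}; hence the caps bind neither
on the optimal trajectory nor in the restricted recursion.
*)
Require Import Defs.
From mathcomp Require Import ring lra measurable_realfun.

Set Implicit Arguments.
Unset Strict Implicit.
Unset Printing Implicit Defensive.

Import Order.TTheory GRing.Theory Num.Theory.
Import numFieldNormedType.Exports.

Local Open Scope classical_set_scope.
Local Open Scope ring_scope.

(** * Integration preliminaries *)

(** A nonnegative integral is a supremum over the simple functions below the integrand, hence
    monotone even without measurability. The expected cost of an arbitrary policy is bounded below
    this way, since its measurability in the level and the demand is never established. *)
Lemma ge0_le_integral_of_measurable_lower d (T : measurableType d) (R : realType)
    (mu : {measure set T -> \bar R}) (f g : T -> \bar R) :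
  (forall x, 0 <= f x)%E -> (forall x, f x <= g x)%E ->
  (\int[mu]_x f x <= \int[mu]_x g x)%E.
Proof.
move=> f0 fg; have g0 x : (0 <= g x)%E by apply: le_trans (fg x).
rewrite !ge0_integralTE//; apply: le_ereal_sup => _ [h hf <-].
by exists h => // x; apply: le_trans (fg x); exact: hf.
Qed.

Lemma measurable_support (R : realType) (B : R) :
  measurable [set x : R | 0 <= x <= B].
Proof.
have -> : [set x : R | 0 <= x <= B] = `[0, B]%classic.
  by apply/seteqP; split => x /=; rewrite in_itv.
exact: measurable_itv.
Qed.

Lemma probability1_ae d (Omega : measurableType d) (R : realType)
    (P : probability Omega R) (A : set Omega) :
  measurable A -> P A = 1%E -> {ae P, forall x, A x}.
Proof.
move=> mA PA; exists (~` A); split => //; first exact: measurableC.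
by rewrite probability_setC// PA subee.
Qed.

(** * Lipschitz and convex functions on the line *)

Section real_functions.
Variable R : realType.
Implicit Types (f g : R -> R) (K : R).

Definition lipschitzR K f := forall x y, `|f x - f y| <= K * `|x - y|.

Definition convexR f := forall t x y, 0 <= t <= 1 ->
  f (t * x + (1 - t) * y) <= t * f x + (1 - t) * f y.

Lemma lipschitzR_continuous K f : lipschitzR K f -> continuous f.
Proof.
move=> fK x; apply/cvgrPdist_lt => e e0.
have K1 : 0 < `|K| + 1 by rewrite ltr_wpDl.
near=> z; apply: le_lt_trans (fK _ _) _.
have xz : `|x - z| < e / (`|K| + 1).
  by near: z; apply: cvgr_dist_lt => //; rewrite divr_gt0.
apply: (@le_lt_trans _ _ ((`|K| + 1) * `|x - z|)).
  by rewrite ler_wpM2r// (le_trans (ler_norm _))// lerDl.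
by rewrite mulrC -ltr_pdivlMr.
Unshelve. all: by end_near. Qed.

Lemma lipschitzR_ge0 K f : lipschitzR K f -> 0 <= K.
Proof. by move=> /(_ 1 0); rewrite subr0 normr1 mulr1; exact: le_trans. Qed.

Lemma lipschitzR_measurable K f : lipschitzR K f -> measurable_fun setT f.
Proof. by move/lipschitzR_continuous/continuous_measurable_fun. Qed.

Lemma maxr_lipschitz (a x y : R) : `|Num.max x a - Num.max y a| <= `|x - y|.
Proof.
wlog xy : x y / x <= y.
  by move=> H; case: (leP x y) => [/H//|/ltW/H]; rewrite distrC [leRHS]distrC.
have mxy : Num.max x a <= Num.max y a by exact: le_max2.
rewrite (distrC x) (distrC (Num.max x a)) !ger0_norm ?subr_ge0//.
by case: (leP x a) mxy; case: (leP y a) => ? ?; lra.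
Qed.

Lemma maxr_convex (a : R) : convexR (fun x => Num.max x a).
Proof.
move=> t x y /andP[t0 t1] /=; have t1' : 0 <= 1 - t by rewrite subr_ge0.
rewrite ge_max; apply/andP; split.
  by apply: lerD; apply: ler_wpM2l => //; rewrite le_max lexx.
have {1}-> : a = t * a + (1 - t) * a by ring.
by apply: lerD; apply: ler_wpM2l => //; rewrite le_max lexx orbT.
Qed.

Lemma lipschitzR_comp_maxr K f a :
  lipschitzR K f -> lipschitzR K (fun x => f (Num.max x a)).
Proof.
move=> fK x y; apply: (le_trans (fK _ _)); apply: ler_wpM2l.
  exact: lipschitzR_ge0 fK.
exact: maxr_lipschitz.
Qed.

(** The inner maximum is convex with values in [[a, +oo[], so [f] has to increase only there. A
    Bellman function is known to increase only above its minimizer. *)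
Lemma convexR_comp_maxr f a : convexR f ->
  (forall x y, a <= x -> x <= y -> f x <= f y) ->
  convexR (fun x => f (Num.max x a)).
Proof.
move=> cf ndf t x y t01.
apply: le_trans (cf t (Num.max x a) (Num.max y a) t01).
apply: ndf; first by rewrite le_max lexx orbT.
exact: maxr_convex.
Qed.

Lemma convexR_le_max f x y z : convexR f -> x <= y <= z ->
  f y <= Num.max (f x) (f z).
Proof.
move=> cf /andP[xy yz].
have [xz|] := ltP x z; last first.
  move=> zx; have -> : y = x.
    by apply/le_anti; rewrite xy (le_trans yz zx).
  by rewrite le_max lexx.
pose t := (z - y) / (z - x).
have zx : 0 < z - x by rewrite subr_gt0.
have t01 : 0 <= t <= 1.
  by rewrite divr_ge0 ?subr_ge0// ?(ltW xz)//= ler_pdivrMr// mul1r; lra.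
have -> : y = t * x + (1 - t) * z by rewrite /t; field; rewrite gt_eqF.
apply: le_trans (cf t x z t01) _; move: t01 => /andP[t0 t1].
set m := Num.max _ _.
have fx : f x <= m by rewrite le_max lexx.
have fz : f z <= m by rewrite le_max lexx orbT.
have -> : m = t * m + (1 - t) * m by ring.
by apply: lerD; apply: ler_wpM2l => //; rewrite subr_ge0.
Qed.

(* Unimodality is all that convexity contributes once a minimizer is known. *)
Lemma convexR_ndecr_after_min f S : convexR f ->
  (forall z, S <= z -> f S <= f z) ->
  forall x y, S <= x -> x <= y -> f x <= f y.
Proof.
move=> cf Smin x y Sx xy.
have := convexR_le_max (x := S) (y := x) (z := y) cf.
rewrite Sx xy => /(_ isT); rewrite le_max => /orP[fxS|//].
by apply: le_trans fxS _; apply: Smin; apply: le_trans xy.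
Qed.

Definition nonneg_minimizers f : set R :=
  [set y | 0 <= y /\ forall z, 0 <= z -> f y <= f z].

Lemma inf_nonneg_minimizers K f h m : lipschitzR K f -> 0 < h ->
  (forall y, h * (y - m) <= f y) ->
  nonneg_minimizers f (inf (nonneg_minimizers f)).
Proof.
move=> fK h0 fm.
have K0 := lipschitzR_ge0 fK.
(* Beyond [f 0 / h + m] the affine lower bound already exceeds [f 0], so a minimizer on [[0, B]] is
   one on the whole half-line. *)
pose B := Num.max 0 (f 0 / h + m).
have B0 : 0 <= B by rewrite le_max lexx.
have [c] := EVT_min B0 (continuous_subspaceT (lipschitzR_continuous fK)).
rewrite in_itv/= => /andP[c0 cB] cmin.
have fc z : 0 <= z -> f c <= f z.
  move=> z0; have [zB|Bz] := leP z B; first by apply: cmin; rewrite in_itv/= z0.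
  apply: (@le_trans _ _ (f 0)); first by apply: cmin; rewrite in_itv/= lexx.
  apply: le_trans (fm z); rewrite mulrC -ler_pdivrMr// lerBrDr.
  by apply: le_trans (ltW Bz); rewrite le_max lexx orbT.
set A := nonneg_minimizers f.
have Ainf : has_inf A.
  by split; [exists c; split | exists 0 => y []].
have i0 : 0 <= inf A by apply: lb_le_inf; [exact: Ainf.1 | move=> y []].
split=> // z z0; apply/ler_addgt0Pl => e e0.
(* Minimizers come arbitrarily close to the infimum, and the Lipschitz bound passes their minimality
   on to it. The [+ 1] keeps the divisor positive when [K = 0]. *)
have K1 : 0 < K + 1 by rewrite ltr_wpDl.
have [y [y0 ymin] yi] := inf_adherent (divr_gt0 e0 K1) Ainf.
have iy : inf A <= y by apply: ge_inf => //; exact: Ainf.2.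
have := fK (inf A) y; rewrite distrC (distrC (inf A)) [X in _ * X]ger0_norm ?subr_ge0// => H.
have H1 := ymin _ z0.
have H2 : K * (y - inf A) <= e.
  apply: (@le_trans _ _ ((K + 1) * (y - inf A))).
    by apply: ler_wpM2r; lra.
  by rewrite mulrC -ler_pdivlMr//; lra.
have := ler_norm (f (inf A) - f y); rewrite distrC => H3.
by lra.
Qed.

End real_functions.

(** * Expectation over the demand *)

Section expectation.
Variables (R : realType) (mu : probability R R).

Lemma integrable_id_of_bounded_support (B : R) :
  mu [set v | 0 <= v <= B] = 1%E ->
  mu.-integrable setT (fun x : R => x%:E).
Proof.
set A := [set v | _] => muA.
have mA : measurable A by exact: measurable_support.
have muAC : mu (~` A) = 0%E by rewrite probability_setC// muA subee.
have mE : measurable_fun setT (fun x : R => `|x%:E|%E).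
  by apply: measurableT_comp => //; exact: EFin_measurable.
apply/integrableP; split; first exact: EFin_measurable.
have -> : (\int[mu]_x `|x%:E| = \int[mu]_(x in A) `|x%:E|)%E.
  rewrite (@ge0_negligible_integral _ _ _ mu setT (~` A))//.
    by rewrite setTD setCK.
  exact: measurableC.
apply: (@le_lt_trans _ _ (\int[mu]_(x in A) `|B|%:E)%E).
  apply: ge0_le_integral => //.
  - exact: measurable_funTS.
  - move=> x /= /andP[x0 xB]; rewrite lee_fin (ger0_norm x0).
    exact: le_trans xB (ler_norm _).
by rewrite integral_cst// [X in (_ * X)%E]muA mule1 ltry.
Qed.

Hypothesis mu_id : mu.-integrable setT (fun x : R => x%:E).
Variables (K : R) (f : R -> R).
Hypothesis fK : lipschitzR K f.

(** Growth is at most linear: [|f 0| + K * |x|] dominates [f], and the first moment of [mu] is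
    finite. *)
Lemma lipschitzR_integrable : mu.-integrable setT (fun x : R => (f x)%:E).
Proof.
have K0 := lipschitzR_ge0 fK.
have mf : measurable_fun setT f := lipschitzR_measurable fK.
apply: (@le_integrable _ _ _ mu setT measurableT _
    (fun x => (`|f 0| + K * `|x|)%:E)).
- exact: measurableT_comp.
- move=> x _ /=; rewrite lee_fin [leRHS]ger0_norm ?addr_ge0 ?mulr_ge0//.
  have := fK x 0; rewrite subr0 => H.
  have -> : f x = f 0 + (f x - f 0) by ring.
  by apply: le_trans (ler_normD _ _) _; rewrite lerD2l.
- under eq_fun do rewrite EFinD EFinM.
  apply: integrableD => //=.
    by apply: finite_measure_integrable_cst.
  apply: integrableZl => //=.
  exact: (integrable_abse mu_id).
Qed.

Lemma lipschitzR_shift y : lipschitzR K (fun d => f (y - d)).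
Proof.
move=> a b; apply: le_trans (fK _ _) _.
by rewrite opprB addrC addrA subrK distrC addrC.
Qed.
End expectation.

Section shifted_expectation.
Variables (R : realType) (mu : probability R R).
Hypothesis mu_id : mu.-integrable setT (fun x : R => x%:E).

Lemma shift_integrable (K : R) (f : R -> R) (y : R) : lipschitzR K f ->
  mu.-integrable setT (fun d : R => (f (y - d))%:E).
Proof. by move=> fK; exact/lipschitzR_integrable/lipschitzR_shift/fK. Qed.

Lemma expectation_cst (c : R) : \int[mu]_d c = c.
Proof. by rewrite Rintegral_cst// [X in fine X]probability_setT mulr1. Qed.

Lemma shift_expectation_lipschitz (K : R) (f : R -> R) : lipschitzR K f ->
  lipschitzR K (fun y => \int[mu]_d f (y - d)).
Proof.
move=> fK x y; rewrite -RintegralB//; [|exact: shift_integrable fK..].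
apply: le_trans (le_normr_Rintegral _ _) _ => //.
  apply: (@eq_integrable _ _ _ mu setT measurableT
    (fun d => (f (x - d))%:E - (f (y - d))%:E)%E) => //.
  by apply: integrableB => //; exact: shift_integrable fK.
rewrite -[leRHS]expectation_cst; apply: le_Rintegral => //.
- have := @integrableB _ _ _ mu _ measurableT _ _
    (shift_integrable x fK) (shift_integrable y fK).
  by move/integrable_abse.
- exact: finite_measure_integrable_cst.
- move=> d _; apply: le_trans (fK _ _) _.
  by rewrite opprB addrA subrK.
Qed.

Lemma shift_expectation_convex (K : R) (f : R -> R) : lipschitzR K f ->
  convexR f -> convexR (fun y => \int[mu]_d f (y - d)).
Proof.
move=> fK cf t x y t01.
have fi z := shift_integrable z fK.
have fZi r z : mu.-integrable setT (EFin \o (fun d => r * f (z - d))).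
  by have := @integrableZl _ _ _ mu _ measurableT r _ (fi z).
rewrite -(RintegralZl t measurableT (fi x)) -(RintegralZl (1 - t) measurableT (fi y)).
rewrite -RintegralD//; apply: le_Rintegral => //.
- exact: fi.
- by have := @integrableD _ _ _ mu _ measurableT _ _ (fZi t x) (fZi (1 - t) y).
- move=> d _; apply: le_trans (cf _ _ _ t01).
  by rewrite le_eqVlt; apply/orP; left; apply/eqP; congr f; ring.
Qed.

Lemma EFin_shift_expectation (K : R) (f : R -> R) (y : R) : lipschitzR K f ->
  (\int[mu]_d (f (y - d))%:E)%E = (\int[mu]_d f (y - d))%:E.
Proof.
by move=> fK; rewrite /Rintegral fineK//; apply: integrable_fin_num => //;
  exact: shift_integrable fK.
Qed.

End shifted_expectation.

(** * One Bellman step *)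

Section bellman_step.
Variable R : realType.
Implicit Types (mu : probability R R) (h p : R) (v : R -> R).

(** One-period cost plus continuation value, as a function of the net inventory [u = y - d] alone.
    Convexity and Lipschitz bounds then pass to the expectation by translation. *)
Definition loss h p v (u : R) : R :=
  h * pospart u + p * pospart (- u) + v (pospart u).

Definition bellman mu h p v (y : R) : R := \int[mu]_d loss h p v (y - d).

Section loss.
Variables (h p K : R) (v : R -> R).
Hypotheses (h0 : 0 < h) (p0 : 0 < p).
Hypotheses (vK : lipschitzR K v) (cv : convexR v).
Hypotheses (ndv : forall x y, x <= y -> v x <= v y) (v0 : forall x, 0 <= v x).

Lemma loss_lipschitz : lipschitzR (h + p + K) (loss h p v).
Proof.
move=> x y; rewrite /loss.
have -> : h * pospart x + p * pospart (- x) + v (pospart x) -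
    (h * pospart y + p * pospart (- y) + v (pospart y)) =
    h * (pospart x - pospart y) + p * (pospart (- x) - pospart (- y)) +
    (v (pospart x) - v (pospart y)) by ring.
rewrite 2!mulrDl.
apply: (le_trans (ler_normD _ _)); apply: lerD.
  apply: (le_trans (ler_normD _ _)).
  rewrite !normrM (gtr0_norm h0) (gtr0_norm p0).
  apply: lerD; apply: ler_wpM2l; rewrite ?(ltW h0) ?(ltW p0)//.
    exact: (maxr_lipschitz 0).
  apply: le_trans (maxr_lipschitz 0 _ _) _.
  by rewrite -opprD normrN.
exact: (lipschitzR_comp_maxr 0 vK).
Qed.

Lemma loss_convex : convexR (loss h p v).
Proof.
move=> t x y t01; rewrite /loss.
have H1 : pospart (t * x + (1 - t) * y) <= t * pospart x + (1 - t) * pospart y.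
  exact: maxr_convex.
have H2 : pospart (t * (- x) + (1 - t) * (- y)) <=
    t * pospart (- x) + (1 - t) * pospart (- y).
  exact: maxr_convex.
have H3 : v (pospart (t * x + (1 - t) * y)) <=
    t * v (pospart x) + (1 - t) * v (pospart y).
  exact: (convexR_comp_maxr cv (fun x y _ => @ndv x y)).
have -> : - (t * x + (1 - t) * y) = t * (- x) + (1 - t) * (- y) by ring.
move: (ler_wpM2l (ltW h0) H1) (ler_wpM2l (ltW p0) H2) H3; lra.
Qed.

Lemma loss_ge0 u : 0 <= loss h p v u.
Proof.
have pp0 w : 0 <= pospart w :> R by rewrite /pospart le_max lexx orbT.
by rewrite /loss !addr_ge0 ?mulr_ge0 ?(ltW h0) ?(ltW p0).
Qed.

Variable mu : probability R R.
Hypothesis mu_id : mu.-integrable setT (fun x : R => x%:E).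

Lemma bellman_lipschitz : lipschitzR (h + p + K) (bellman mu h p v).
Proof. exact: shift_expectation_lipschitz loss_lipschitz. Qed.

Lemma bellman_convex : convexR (bellman mu h p v).
Proof. exact: shift_expectation_convex loss_lipschitz loss_convex. Qed.

Lemma bellman_ge0 y : 0 <= bellman mu h p v y.
Proof. by apply: Rintegral_ge0 => d _; exact: loss_ge0. Qed.

Lemma EFin_bellman y :
  (\int[mu]_d (loss h p v (y - d))%:E)%E = (bellman mu h p v y)%:E.
Proof. exact: EFin_shift_expectation loss_lipschitz. Qed.

(** Only the holding term is kept, with [y - d] below its positive part. This linear growth makes
    the least minimizer exist. *)
Lemma bellman_coercive y : h * (y - \int[mu]_d d) <= bellman mu h p v y.
Proof.
have ic := finite_measure_integrable_cst mu y measurableT.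
rewrite -{1}(expectation_cst mu y) -RintegralB// -RintegralZl//; last first.
  by have := @integrableB _ _ _ mu _ measurableT _ _ ic mu_id.
apply: le_Rintegral => //.
- have := @integrableB _ _ _ mu _ measurableT _ _ ic mu_id.
  by move=> /(@integrableZl _ _ _ mu _ measurableT h).
- exact: shift_integrable loss_lipschitz.
- move=> d _; rewrite /loss -addrA -[leLHS]addr0 lerD//.
    by rewrite ler_wpM2l ?(ltW h0)// /pospart le_max lexx.
  by rewrite addr_ge0// mulr_ge0 ?(ltW p0)// /pospart le_max lexx orbT.
Qed.

Lemma bellman_argmin : nonneg_minimizers (bellman mu h p v)
  (inf (nonneg_minimizers (bellman mu h p v))).
Proof. exact: inf_nonneg_minimizers bellman_lipschitz h0 bellman_coercive. Qed.

Lemma measurable_lt (u : R) : measurable [set x : R | x < u].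
Proof.
have -> : [set x : R | x < u] = `]-oo, u[%classic.
  by apply/seteqP; split => x /=; rewrite in_itv.
exact: measurable_itv.
Qed.

(* The right-hand side is a lower bound for the slope of the one-period cost:
   raising the level from u to a costs h per unit when the demand is below u
   and saves at most p per unit otherwise. *)
Lemma bellman_slope u a : u <= a ->
  (a - u) * ((h + p) * fine (mu [set x | x < u]) - p) <=
  bellman mu h p v a - bellman mu h p v u.
Proof.
move=> ua.
have iL z : mu.-integrable setT (EFin \o (fun d => loss h p v (z - d))).
  exact: shift_integrable loss_lipschitz.
have i1 : mu.-integrable setT (EFin \o (\1_[set x : R | x < u] : R -> R)).
  exact: integrable_indic (measurable_lt u).
have i2 : mu.-integrable setT (EFin \o (fun d => (h + p) * \1_[set x : R | x < u] d)).
  by have := @integrableZl _ _ _ mu _ measurableT (h + p) _ i1.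
have ip := finite_measure_integrable_cst mu p measurableT.
have i3 : mu.-integrable setT (EFin \o (fun d => (h + p) * \1_[set x : R | x < u] d - p)).
  by have := @integrableB _ _ _ mu _ measurableT _ _ i2 ip.
(* Writing the probability as the integral of an indicator reduces the claim to an inequality for
   each demand. *)
have -> : fine (mu [set x : R | x < u]) = \int[mu]_d \1_[set x : R | x < u] d.
  by rewrite /Rintegral integral_indic ?setIT//; exact: measurable_lt.
rewrite -{2}(expectation_cst mu p) -RintegralZl// -RintegralB// -RintegralZl//.
rewrite /bellman -RintegralB//.
apply: le_Rintegral => //.
- by have := @integrableZl _ _ _ mu _ measurableT (a - u) _ i3.
- by have := @integrableB _ _ _ mu _ measurableT _ _ (iL a) (iL u).
- move=> d _; rewrite indicE /loss.
  have nd : v (pospart (u - d)) <= v (pospart (a - d)).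
    by apply: ndv; apply: le_max2; rewrite ?lerB.
  have [du|ud] := ltP d u.
    have E z : d < z -> pospart (z - d) = z - d /\ pospart (- (z - d)) = 0.
      by move=> dz; rewrite /pospart; split; [apply: max_l|apply: max_r]; lra.
    have [E1 E2] := E _ du; have [E3 E4] := E _ (lt_le_trans du ua).
    rewrite E1 E3 in nd; rewrite mem_set//= E1 E2 E3 E4; lra.
  rewrite memNset/=; last by apply/negP; rewrite -leNgt.
  have [hh pp] : h * pospart (u - d) <= h * pospart (a - d) /\
      p * (pospart (- (u - d))- (a - u)) <= p * pospart (- (a - d)).
    split; apply: ler_wpM2l; rewrite ?(ltW h0) ?(ltW p0)// /pospart.
      by apply: le_max2 => //; lra.
    by case: (leP (- (u - d)) 0); case: (leP (- (a - d)) 0) => ? ?; lra.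
  by lra.
Qed.
End loss.

(** Left continuity of [P(D < a)] in [a], by continuity of the measure from below along
    [a - 1/(n+1)]. It leaves an interval [[u, a]] over which the Bellman function strictly
    increases. *)
Lemma exists_lt_measure_gt mu (a q : R) : (q%:E < mu [set x | x < a]%R)%E ->
  exists2 u, u < a & (q%:E < mu [set x | x < u]%R)%E.
Proof.
move=> qa; apply/not_exists2P => H.
pose F (n : nat) : set R := [set x | x < a - n.+1%:R^-1].
have FU : \bigcup_n F n = [set x | x < a].
  apply/seteqP; split => x /=.
    by move=> [n _]; rewrite /F/= => /lt_le_trans; apply; rewrite gerBl.
  (* This index satisfies [n + 1 > 1 / (a - x)], that is [x < a - 1/(n+1)]. *)
  move=> xa; exists (Num.truncn (a - x)^-1) => //; rewrite /F/= ltrBrDl -ltrBrDr.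
  rewrite -[ltRHS]invrK ltf_pV2 ?posrE ?invr_gt0 ?subr_gt0//.
  exact: truncnS_gt.
have := @nondecreasing_cvg_mu _ _ _ mu F (fun n => measurable_lt _).
rewrite FU => /(_ (measurable_lt _)).
have nd : {homo F : n m / (n <= m)%N >-> (n <= m)%O}.
  move=> n m nm; rewrite /F; apply/subsetPset => x /= /lt_le_trans; apply.
  by rewrite lerB// lef_pV2 ?posrE// ler_nat.
move=> /(_ nd) cv; move: qa; apply/negP; rewrite -leNgt.
apply: (cvge_le _ cv); apply: nearW => n /=.
have [//|H1] := H (a - n.+1%:R^-1); first by rewrite ltrBlDr ltrDl.
by rewrite leNgt; apply/negP.
Qed.

(** By the slope bound some [u < a] has a strictly smaller value than [a]. If [a <= S], convexity on
    [u < a <= S] would bound the value at [a] by the larger of those at [u] and [S], which is the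
    one at [u]. *)
Lemma bellman_minimizer_lt mu h p K v B a S : 0 < h -> 0 < p ->
  lipschitzR K v -> convexR v ->
  (forall x y, x <= y -> v x <= v y) ->
  mu [set x | 0 <= x <= B] = 1%E ->
  ((p / (h + p))%:E < mu [set x | x < a]%R)%E ->
  nonneg_minimizers (bellman mu h p v) S -> S < a.
Proof.
move=> h0 p0 vK cv ndv mu1 qa [S0 Smin].
have mu_id := integrable_id_of_bounded_support mu1.
have hp : 0 < h + p by rewrite addr_gt0.
have [u ua qu] := exists_lt_measure_gt qa.
(* [S] is compared with nonnegative levels only. A negative [u] has [P(D < u) = 0], which cannot
   exceed the critical ratio. *)
have u0 : 0 <= u.
  rewrite leNgt; apply/negP => u0; move: qu; apply/negP; rewrite -leNgt.
  have mC := measurable_support B.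
  have mu0 : mu (~` [set x : R | 0 <= x <= B]) = 0%E by rewrite probability_setC// mu1 subee.
  apply: (@le_trans _ _ 0%E); last by rewrite lee_fin divr_ge0 ?ltW.
  rewrite -mu0; apply: le_measure; rewrite ?inE//; first exact: measurable_lt.
    exact: measurableC.
  by move=> x /= xu /andP[x0 _]; move: (le_lt_trans x0 (lt_trans xu u0)); rewrite ltxx.
have qu' : p < (h + p) * fine (mu [set x : R | x < u]).
  rewrite mulrC -ltr_pdivrMr// -lte_fin fineK//; exact: fin_num_measure (measurable_lt u).
have Fua : bellman mu h p v u < bellman mu h p v a.
  rewrite -subr_gt0; apply: lt_le_trans (bellman_slope h0 p0 vK ndv mu_id (ltW ua)).
  by rewrite mulr_gt0// subr_gt0.
rewrite ltNge; apply/negP => aS.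
have := convexR_le_max (x := u) (y := a) (z := S) (bellman_convex h0 p0 vK cv ndv mu_id).
rewrite (ltW ua) aS => /(_ isT).
by rewrite (max_l (Smin _ u0)) leNgt Fua.
Qed.

End bellman_step.

(** * Dynamic programming and caps *)

Section lost_sales_theory.
Variables (R : realType) (M : model R) (Dbar : R).
Local Notation T := (horizon M).
Hypothesis hp0 : forall t, period T t -> 0 < holding M t /\ 0 < shortage M t.
Hypothesis law_support :
  forall t, period T t -> law M t [set v | 0 <= v <= Dbar] = 1%E.

Lemma measurable_base_stock_level k (S : R) :
  measurable_fun [set: history R k] (fun h => Num.max (Num.max (thead h) 0) S).
Proof.
by do 2![apply: measurable_funM_max || apply: measurable_maxr => //];
  exact: measurable_tnth.
Qed.

(** A deterministic rule as a Dirac kernel. The maximum with 0 makes it feasible on every history,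
    including those with a negative current entry. *)
Definition base_stock_policy (S : nat -> R) : policy R :=
  fun s k => kdirac (@measurable_base_stock_level k (S s)).

Lemma feasible_base_stock_policy S : feasible (base_stock_policy S).
Proof.
move=> s k h; rewrite /base_stock_policy/= /kdirac diracE mem_set//=.
by rewrite le_max lexx.
Qed.

Definition value t (x : R) : R := fine (optimal_value M t x).

(** The backward induction hypothesis. The last two fields range over all histories and accumulated
    costs because [expected_cost] hands these on to later periods. *)
Record dp_spec t : Prop := DPSpec {
  dp_lipschitz : exists K, lipschitzR K (value t);
  dp_convex : convexR (value t);
  dp_ndecr : forall x y, x <= y -> value t x <= value t y;
  dp_ge0 : forall x, 0 <= value t x;
  dp_optimal : forall x, optimal_value M t x = (value t x)%:E;
  dp_lower : forall pi, feasible pi -> forall k (h : history R k) acc,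
    0 <= acc ->
    ((acc + value t (thead h))%:E <= expected_cost M pi (T.+1 - t) t h acc)%E;
  dp_attained : forall k (h : history R k) acc,
    expected_cost M (base_stock_policy (Sstar M)) (T.+1 - t) t h acc =
    (acc + value t (thead h))%:E }.

(** Attainment by the base-stock policy bounds the infimum over policies from above, and the bound
    for every feasible policy, taken at accumulated cost 0, bounds it from below. *)
Lemma dp_specI t v K : lipschitzR K v -> convexR v ->
  (forall x y, x <= y -> v x <= v y) -> (forall x, 0 <= v x) ->
  (forall pi, feasible pi -> forall k (h : history R k) acc, 0 <= acc ->
    ((acc + v (thead h))%:E <= expected_cost M pi (T.+1 - t) t h acc)%E) ->
  (forall k (h : history R k) acc,
    expected_cost M (base_stock_policy (Sstar M)) (T.+1 - t) t h acc =
    (acc + v (thead h))%:E) ->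
  dp_spec t /\ value t = v.
Proof.
move=> vK cv ndv v0 vlow vatt.
have opt x : optimal_value M t x = (v x)%:E.
  apply/le_anti/andP; split.
    apply: ereal_inf_lbound; exists (base_stock_policy (Sstar M)).
      exact: feasible_base_stock_policy.
    by rewrite /policy_value vatt add0r.
  apply: le_ereal_inf_tmp => _ [pi fpi <-]; rewrite /policy_value.
  by apply: le_trans (vlow _ fpi _ _ _ (lexx 0)); rewrite add0r.
have vE : value t = v by apply/funext => x; rewrite /value opt.
by split=> //; split; rewrite ?vE//; exists K.
Qed.

Lemma dp_terminal : dp_spec T.+1 /\ value T.+1 = cst 0.
Proof.
apply: (@dp_specI T.+1 (cst 0) 0).
- by move=> x y; rewrite subrr normr0 mul0r.
- by move=> t x y _; rewrite !mulr0 addr0.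
- by [].
- by [].
- by move=> pi _ k h acc _; rewrite subnn/= addr0.
- by move=> k h acc; rewrite subnn/= addr0.
Qed.

(** * The backward induction step *)

Section step.
Variable t : nat.
Hypotheses (tT : period T t) (spec : dp_spec t.+1).

Let h0 : 0 < holding M t := (hp0 tT).1.
Let p0 : 0 < shortage M t := (hp0 tT).2.
Let law_id := integrable_id_of_bounded_support (law_support tT).

(** The real-valued form of [post_order_value]; [post_order_valueE] identifies the two once
    [dp_spec t.+1] is known. *)
Definition stage_value := bellman (law M t) (holding M t) (shortage M t) (value t.+1).

Let stageK : exists K, lipschitzR K stage_value.
Proof.
have [K vK] := dp_lipschitz spec.
by exists (holding M t + shortage M t + K); apply: bellman_lipschitz.
Qed.

Lemma cost_lossE v y d :
  cost M t y d + v (pospart (y - d)) = loss (holding M t) (shortage M t) v (y - d).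
Proof. by rewrite /loss opprB. Qed.

Let measurable_stage : measurable_fun setT (fun y => (stage_value y)%:E).
Proof. by have [K /lipschitzR_measurable mF] := stageK; exact/measurable_EFinP. Qed.

Let cost_ge0 y d : 0 <= cost M t y d.
Proof.
by rewrite /cost /pospart addr_ge0// mulr_ge0 ?(ltW h0) ?(ltW p0)// le_max lexx orbT.
Qed.

Lemma shift_measurable K (f : R -> R) (y : R) :
  lipschitzR K f -> measurable_fun setT (fun d : R => (f (y - d))%:E).
Proof.
move=> fK; apply/measurable_EFinP.
exact: lipschitzR_measurable (lipschitzR_shift fK y).
Qed.

Lemma mean_costD (g : R -> \bar R) y :
  measurable_fun setT g -> (forall x, 0 <= g x)%E ->
  (mean_cost M t y + \int[law M t]_d g d = \int[law M t]_d ((cost M t y d)%:E + g d))%E.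
Proof.
move=> mg g0; rewrite /mean_cost -ge0_integralD//.
  by move=> d _; rewrite lee_fin cost_ge0.
have -> : (fun d => (cost M t y d)%:E) =
    (fun d => (loss (holding M t) (shortage M t) (cst 0) (y - d))%:E).
  by apply/funext => d; rewrite -cost_lossE addr0.
apply: (@shift_measurable (holding M t + shortage M t + 0)).
by apply: loss_lipschitz => // x z; rewrite subrr normr0 mul0r.
Qed.

Lemma post_order_valueE y : post_order_value M t y = (stage_value y)%:E.
Proof.
have [K vK] := dp_lipschitz spec.
rewrite /post_order_value.
under eq_integral do rewrite (dp_optimal spec).
rewrite mean_costD.
- under eq_integral do rewrite -EFinD cost_lossE.
  exact: (EFin_bellman h0 p0 vK).
- exact: (@shift_measurable K (fun u => value t.+1 (pospart u)) y
    (lipschitzR_comp_maxr 0 vK)).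
- by move=> x; rewrite lee_fin; exact: dp_ge0.
Qed.

Lemma minimizersE : minimizers M t = nonneg_minimizers stage_value.
Proof.
apply/seteqP; split => y [y0 ymin]; split => // z z0; have := ymin z z0;
  by rewrite !post_order_valueE lee_fin.
Qed.

Lemma Sstar_min : minimizers M t (Sstar M t).
Proof.
have [K vK] := dp_lipschitz spec.
rewrite /Sstar minimizersE.
apply: bellman_argmin (dp_ge0 spec) _ _ => //.
Qed.

Lemma Sstar_ge0 : 0 <= Sstar M t. Proof. by case: Sstar_min. Qed.

Lemma stage_value_ndecr x y : Sstar M t <= x -> x <= y ->
  stage_value x <= stage_value y.
Proof.
have [K vK] := dp_lipschitz spec.
apply: (@convexR_ndecr_after_min _ stage_value (Sstar M t)).
  exact (bellman_convex h0 p0 vK (dp_convex spec) (@dp_ndecr _ spec) law_id).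
move=> z Sz; have := Sstar_min; rewrite minimizersE => -[S0 Smin].
by apply: Smin; exact: le_trans Sz.
Qed.

(** Either [x] is at most [Sstar M t], a minimizer over all nonnegative levels, or the maximum is
    [x] and the stage value increases from there on. So no level allowed at [x] beats the base-stock
    level. *)
Lemma stage_value_le x y : x <= y -> 0 <= y ->
  stage_value (Num.max x (Sstar M t)) <= stage_value y.
Proof.
move=> xy y0; have := Sstar_min; rewrite minimizersE => -[S0 Smin].
have [xS|Sx] := leP x (Sstar M t); first exact: Smin.
exact: stage_value_ndecr (ltW Sx) xy.
Qed.

Lemma integral_acc_stage acc y :
  (\int[law M t]_d (acc + cost M t y d + value t.+1 (pospart (y - d)))%:E)%E =
  (acc + stage_value y)%:E.
Proof.
have [K vK] := dp_lipschitz spec.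
under eq_integral do rewrite -addrA cost_lossE EFinD.
rewrite integralD//; last 2 first.
- exact: finite_measure_integrable_cst.
- exact: shift_integrable (loss_lipschitz h0 p0 vK).
by rewrite integral_cst// [X in (_ * X)%E]probability_setT mule1 (EFin_bellman h0 p0 vK).
Qed.

Lemma dp_step : dp_spec t /\
  value t = fun x => stage_value (Num.max x (Sstar M t)).
Proof.
have [K FK] := stageK.
have [K' vK] := dp_lipschitz spec.
have tT1 : (T.+1 - t = (T.+1 - t.+1).+1)%N.
  by have /andP[_ tT'] := tT; rewrite subSS subSn.
have F0 y : 0 <= stage_value y by apply: bellman_ge0 => //; exact: dp_ge0.
apply: (@dp_specI t _ K).
- exact: lipschitzR_comp_maxr.
- apply: (@convexR_comp_maxr _ stage_value); last exact: stage_value_ndecr.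
  exact (bellman_convex h0 p0 vK (dp_convex spec) (@dp_ndecr _ spec) law_id).
- move=> x y xy; apply: stage_value_ndecr; first by rewrite le_max lexx orbT.
  exact: le_max2.
- by [].
- move=> pi fpi k h acc acc0; rewrite tT1/=.
  (* The induction hypothesis bounds the continuation for each level and demand, leaving only the
     integral over the level drawn by the policy. *)
  apply: (@le_trans _ _ (\int[pi t k h]_y (acc + stage_value y)%:E)%E); last first.
    apply: ge0_le_integral_of_measurable_lower => y.
      by rewrite lee_fin addr_ge0.
    rewrite -integral_acc_stage.
    apply: ge0_le_integral_of_measurable_lower => d.
      by rewrite lee_fin addr_ge0 ?(dp_ge0 spec)// addr_ge0.
    have := dp_lower spec fpi (extend_history h y (pospart (y - d))).
    by rewrite theadE; apply; rewrite addr_ge0.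
  (* The feasible levels have probability one under the draw, and on them [stage_value_le] gives a
     constant lower bound. *)
  pose A : set R := [set y | Num.max (thead h) 0 <= y].
  have mA : measurable A.
    have -> : A = `[Num.max (thead h) 0, +oo[%classic.
      by apply/seteqP; split => y /=; rewrite in_itv/= andbT.
    exact: measurable_itv.
  have mF : measurable_fun setT (fun y => (acc + stage_value y)%:E).
    by under eq_fun do rewrite EFinD; apply: emeasurable_funD.
  apply: (@le_trans _ _ (\int[pi t k h]_(y in A) (acc + stage_value y)%:E)%E); last first.
    by apply: ge0_subset_integral => // y _; rewrite lee_fin addr_ge0.
  apply: (@le_trans _ _ (\int[pi t k h]_(y in A)
      (acc + stage_value (Num.max (thead h) (Sstar M t)))%:E)%E).
    by rewrite integral_cst// [X in (_ * X)%E](fpi t k h) mule1.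
  apply: ge0_le_integral => //.
  + by move=> y _; rewrite lee_fin addr_ge0.
  + exact: measurable_funTS.
  + move=> y; rewrite /A/= ge_max => /andP[hy y0].
    by rewrite lee_fin lerD2l; exact: stage_value_le.
- move=> k h acc; rewrite tT1/=.
  have -> : (fun y => \int[law M t]_d expected_cost M (base_stock_policy (Sstar M))
      (T.+1 - t.+1) t.+1 (extend_history h y (pospart (y - d))) (acc + cost M t y d))%E
      = (fun y => (acc + stage_value y)%:E).
    apply/funext => y; rewrite -integral_acc_stage; apply: eq_integral => d _.
    by rewrite (dp_attained spec) theadE.
  (* The Dirac mass sits at the base-stock level; truncation of the inventory at 0 is absorbed
     because [Sstar M t] is nonnegative. *)
  rewrite integral_dirac//.
    by rewrite diracT mul1e -maxA [Num.max 0 _]max_r// Sstar_ge0.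
  by under eq_fun do rewrite EFinD; apply: emeasurable_funD.
Qed.

End step.

Lemma dp_all t : (1 <= t <= T.+1)%N -> dp_spec t.
Proof.
move=> /andP[t1 tT]; have := subnKC tT; move: (T.+1 - t)%N => n.
elim: n t t1 {tT} => [|n IH] t t1 tn.
  by move: tn; rewrite addn0 => ->; exact: dp_terminal.1.
have tT : period T t by rewrite /period t1 -ltnS -tn -[X in (X < _)%N]addn0 ltn_add2l.
by apply: (dp_step tT (IH _ _ _)).1 => //; rewrite addSnnS.
Qed.

Lemma dp_next t : period T t -> dp_spec t.+1.
Proof. by move=> /andP[_ tT]; apply: dp_all; rewrite ltnS. Qed.

Lemma valueE t : period T t ->
  value t = fun x => stage_value t (Num.max x (Sstar M t)).
Proof. by move=> tT; exact: (dp_step tT (dp_next tT)).2. Qed.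

(** * Nondecreasing caps and the restricted recursion *)

Section caps.
Variable a : nat -> R.
Hypothesis a_ndecr : forall t, period T t -> period T t.+1 -> a t <= a t.+1.
Hypothesis a_ratio :
  forall t, period T t -> ((critical_ratio M t)%:E < Fminus M t (a t))%E.

Lemma Sstar_lt_cap t : period T t -> Sstar M t < a t.
Proof.
move=> tT; have [K vK] := dp_lipschitz (dp_next tT).
have [h0 p0] := hp0 tT.
apply: (bellman_minimizer_lt h0 p0 vK (dp_convex (dp_next tT))
  (@dp_ndecr _ (dp_next tT)) (law_support tT) (a_ratio tT)).
by have := Sstar_min tT (dp_next tT); rewrite (minimizersE tT (dp_next tT)).
Qed.

Lemma cap_ge0 t : period T t -> 0 <= a t.
Proof.
by move=> tT; apply: le_trans (ltW (Sstar_lt_cap tT)); exact: Sstar_ge0 (dp_next tT).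
Qed.

(** Pathwise induction: ordering up to [Sstar M t] stays below the cap, a nonnegative demand only
    lowers the level, and the next cap is no smaller. *)
Lemma trajectory_le_cap x1 dem t : x1 <= a 1%N ->
  (forall s, period T s -> 0 <= dem s) -> period T t ->
  pre_order (Sstar M) x1 dem t <= a t /\ post_order (Sstar M) x1 dem t <= a t.
Proof.
move=> x1a dem0 tT.
have post s : period T s -> pre_order (Sstar M) x1 dem s <= a s ->
    post_order (Sstar M) x1 dem s <= a s.
  by move=> sT xs; rewrite /post_order /base_stock ge_max xs ltW// Sstar_lt_cap.
suff pre : pre_order (Sstar M) x1 dem t <= a t by split=> //; exact: post.
elim: t tT => [|[|t] IH] tT //.
have tT' : period T t.+1 by move: tT => /andP[_ /ltnW]; rewrite /period.
rewrite /pre_order -/pre_order /pospart ge_max cap_ge0// andbT.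
have := post _ tT' (IH tT'); rewrite /post_order => yt.
rewrite lerBlDr; apply: le_trans yt _; apply: le_trans (a_ndecr tT' tT) _.
by rewrite lerDl dem0.
Qed.

Lemma capped_value_terminal x : capped_value M a T.+1 x = 0%E.
Proof. by rewrite /capped_value subnn. Qed.

Lemma capped_value_step t x : period T t ->
  capped_value M a t x =
  ereal_inf [set capped_post_order_value M a t y | y in [set y | x <= y <= a t]].
Proof.
by move=> /andP[_ tT]; rewrite /capped_value/= subSn.
Qed.

Lemma demand_ge0_ae t : period T t -> {ae law M t, forall d, 0 <= d}.
Proof.
move=> tT; apply: filterS (probability1_ae (measurable_support _) (law_support tT)).
by move=> d /= /andP[].
Qed.

(* Above its cap the restricted problem is infeasible, hence infinite; a
   level y <= a t never leads there, except on null sets of demands. *)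
Lemma capped_value_post t :
  period T t ->
  (forall x, 0 <= x -> capped_value M a t.+1 x =
     if (T <= t)%N || (x <= a t.+1) then (value t.+1 x)%:E else +oo%E) ->
  forall y, y <= a t -> capped_post_order_value M a t y = (stage_value t y)%:E.
Proof.
move=> tT cE y ya; rewrite -post_order_valueE//; last exact: dp_next.
have [K vK] := dp_lipschitz (dp_next tT).
have pp0 u : 0 <= pospart u :> R by rewrite /pospart le_max lexx orbT.
rewrite /capped_post_order_value /post_order_value; congr (_ + _)%E.
have mv : measurable_fun setT (fun d : R => (value t.+1 (pospart (y - d)))%:E).
  exact: (@shift_measurable K (fun u => value t.+1 (pospart u)) y
    (lipschitzR_comp_maxr 0 vK)).
apply: ge0_ae_eq_integral => //.
- under eq_fun do rewrite cE//.
  case: (leqP T t) => tT' //=.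
  apply: measurable_fun_ifT => //.
  apply: measurable_fun_ler => //.
  apply: (lipschitzR_measurable (K := 1)); apply: (@lipschitzR_shift _ 1 (@pospart R)).
  by move=> u z; rewrite mul1r; exact: maxr_lipschitz.
- by under eq_fun do rewrite (dp_optimal (dp_next tT)).
- move=> d _; rewrite cE//; case: ifP => // _.
  by rewrite lee_fin; exact: (dp_ge0 (dp_next tT)).
- move=> d _; rewrite (dp_optimal (dp_next tT)) lee_fin; exact: (dp_ge0 (dp_next tT)).
- apply: filterS (demand_ge0_ae tT) => d d0 _ /=.
  rewrite cE// (dp_optimal (dp_next tT)).
  have [//|tT' /=] := leqP T t.
  have tT1 : period T t.+1 by rewrite /period.
  rewrite (_ : pospart (y - d) <= a t.+1)// /pospart ge_max cap_ge0// andbT.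
  by rewrite lerBlDr; apply: le_trans ya _; rewrite ler_wpDr// a_ndecr.
Qed.

(** Both [x] and [Sstar M t] lie below the cap, so the unrestricted optimal level is itself
    admissible. *)
Lemma capped_value_base_stock t x :
  period T t ->
  (forall y, y <= a t -> capped_post_order_value M a t y = (stage_value t y)%:E) ->
  0 <= x <= a t -> capped_value M a t x = (value t x)%:E.
Proof.
move=> tT pE /andP[x0 xa]; rewrite capped_value_step// valueE//.
have Sa := ltW (Sstar_lt_cap tT).
have ma : Num.max x (Sstar M t) <= a t by rewrite ge_max xa.
apply/le_anti/andP; split.
  rewrite -pE//; apply: ereal_inf_lbound; exists (Num.max x (Sstar M t)) => //=.
  by rewrite le_max lexx.
apply: le_ereal_inf_tmp => _ [y /= /andP[xy ya] <-].
rewrite pE// lee_fin; apply: stage_value_le => //; first exact: dp_next.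
exact: le_trans xy.
Qed.

(** The induction carries the infinite values above the cap as well, because the next value is
    integrated over all inventories reached. Past the horizon there is no cap and the value is 0. *)
Lemma capped_valueE t : (1 <= t <= T.+1)%N -> forall x, 0 <= x ->
  capped_value M a t x =
  if (T < t)%N || (x <= a t) then (value t x)%:E else +oo%E.
Proof.
move=> /andP[t1 tT]; have := subnKC tT; move: (T.+1 - t)%N => n.
elim: n t t1 {tT} => [|n IH] t t1 tn x x0.
  move: tn; rewrite addn0 => ->.
  by rewrite capped_value_terminal ltnSn/= dp_terminal.2.
have tT : (t <= T)%N by rewrite -ltnS -tn -[X in (X < _)%N]addn0 ltn_add2l.
have tP : period T t by rewrite /period t1.
rewrite ltnNge tT/=; case: ifPn => [xa|].
  apply: capped_value_base_stock => //; last by rewrite x0.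
  by apply: capped_value_post => //; apply: IH => //; rewrite addSnnS.
rewrite -ltNge => ax; rewrite capped_value_step//.
rewrite (_ : [set y | _] = set0) ?image_set0 ?ereal_inf0//.
apply/seteqP; split => y //= /andP[xy ya].
by move: (lt_le_trans ax (le_trans xy ya)); rewrite ltxx.
Qed.

Lemma capped_post_order_valueE t y : period T t -> y <= a t ->
  capped_post_order_value M a t y = (stage_value t y)%:E.
Proof.
move=> tT; apply: capped_value_post => //.
by apply: capped_valueE; move: tT => /andP[_]; rewrite ltnS.
Qed.

End caps.
End lost_sales_theory.

(** Splitting off the index [t] leaves the minimum that defines the next cap; at [t = T] that range
    is empty and the default [lam T] remains. *)
Lemma carry_cap_ndecr (R : realType) (M : model R) lam t :
  (t <= horizon M)%N -> carry_cap M lam t <= carry_cap M lam t.+1.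
Proof. by move=> tT; rewrite /carry_cap big_ltn// ge_min lexx orbT. Qed.

Theorem theorem4 (R : realType) (M : model R) (Dbar : R)
    (d : measure_display) (Omega : measurableType d) (P : probability Omega R)
    (D : nat -> {RV P >-> R})
    (d' : measure_display) (Omega' : measurableType d')
    (Q : probability Omega' R) (L : sales_log Q) (lam : nat -> Omega' -> R)
    (x1 : R) :
  let T := horizon M in
  (0 < T)%N ->
  0 < Dbar ->
  (forall t, period T t -> 0 < holding M t /\ 0 < shortage M t) ->
  (forall t, period T t -> law M t [set v | 0 <= v <= Dbar] = 1%E) ->
  (forall t, period T t -> has_law P (D t) (law M t)) ->
  mutually_independent P (period T) (fun t => D t) ->
  noninformative_censoring M L ->
  admissible_caps M L lam ->
  (forall t w, period T t -> 0 <= lam t w <= Dbar) ->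
  forall w : Omega',
  let a := carry_cap M (fun t => lam t w) in
  0 <= x1 <= a 1%N ->
  (forall t, period T t -> ((critical_ratio M t)%:E < Fminus M t (a t))%E) ->
  [/\ forall t, period T t ->
        minimizers M t (Sstar M t) /\ Sstar M t < a t,
      {ae P, forall omega, forall t, period T t ->
        pre_order (Sstar M) x1 (fun s => D s omega) t <= a t /\
        post_order (Sstar M) x1 (fun s => D s omega) t <= a t} &
      forall t x, period T t -> 0 <= x <= a t ->
        (exists y, x <= y <= a t /\
           capped_value M a t x = capped_post_order_value M a t y) /\
        capped_value M a t x = optimal_value M t x].
Proof.
move=> T T0 B0 hp0 supp lawD _ _ _ _ w a /andP[x10 x1a] ratio.
have nda t : period T t -> period T t.+1 -> a t <= a t.+1.
  by move=> /andP[_ tT] _; exact: carry_cap_ndecr.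
split.
- move=> t tT; split; last exact: (Sstar_lt_cap hp0 supp ratio).
  exact (Sstar_min hp0 supp tT (dp_next hp0 supp tT)).
(* The law of each demand gives nonnegativity off a null set, and a countable union of null sets
   covers all periods at once. *)
- have D0 : {ae P, forall omega, forall t, period T t -> 0 <= D t omega}.
    apply: ae_foralln => t; have [tT|tT] := boolP (period T t); last first.
      by apply: aeW => omega.
    have mA := measurable_support Dbar.
    have mD : measurable (D t @^-1` [set v | 0 <= v <= Dbar]).
      by rewrite -[X in measurable X]setTI; exact: measurable_funP.
    have PD : P (D t @^-1` [set v | 0 <= v <= Dbar]) = 1%E.
      by rewrite (lawD t tT _ mA) supp.
    by apply: filterS (probability1_ae mD PD) => omega /= /andP[].
  apply: filterS D0 => omega D0 t tT.
  exact: (trajectory_le_cap hp0 supp nda ratio).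
- move=> t x tT /andP[x0 xa].
  have cE : capped_value M a t x = (value M t x)%:E.
    rewrite (capped_valueE hp0 supp nda ratio)//; last first.
      by move: tT => /andP[-> /leqW].
    by rewrite xa orbT.
  split; last by rewrite cE (dp_optimal (dp_all hp0 supp _))//; move: tT => /andP[-> /leqW].
  (* The base-stock level attains the restricted minimum, so the infimum in [capped_rec] is a
     genuine minimum. *)
  exists (Num.max x (Sstar M t)).
  have ma : Num.max x (Sstar M t) <= a t.
    by rewrite ge_max xa ltW// (Sstar_lt_cap hp0 supp ratio).
  rewrite ma le_max lexx; split=> //.
  by rewrite cE (valueE hp0 supp tT) (capped_post_order_valueE hp0 supp nda ratio tT).
Qed.
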